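(* Let $A$ be a unital ring, $G$ a group, and $\alpha:G\to\mathrm{Aut}(A)$ an action. Let $S$ be a submonoid of $G$ with $G=S^{-1}S$, and suppose there is a nontrivial idempotent $e\in A$ such that $\alpha_s(e)\le e$ for all $s\in S$. Let $\alpha':S\to\mathrm{Endr}(eAe)$ be the action by corner isomorphisms obtained by restriction, $\alpha'_s=\alpha_s|_{eAe}$. Then the rings $S^{\mathrm{op}}*_{\alpha'}(eAe)*_{\alpha'}S$ and $e(A*_\alpha G)e$ are isomorphic as $G$-graded rings.
   Context: $\mathrm{Endr}(B)$ is the monoid (under composition) of not necessarily unital ring endomorphisms of a ring $B$. $G=S^{-1}S$ means every element of $G$ has the form $s^{-1}t$ with $s,t\in S$. For idempotents, $f\le e$ means $ef=fe=f$. Nontrivial means $e\ne 0,1$. $A*_\alpha G$ is the skew group ring: formal finite sums $\sum_{g\in G}a_gg$ with $a_g\in A$ and multiplication $(ag)(bh)=(a\alpha_g(b))(gh)$; it is $G$-graded with $g$-component $Ag$, and $e(A*_\alpha G)e$ is $G$-graded with $g$-component $e(Ag)e$. An action of $S$ on a ring $B$ by corner isomorphisms is a monoid homomorphism $\beta:S\to\mathrm{Endr}(B)$ such that each $\beta_s$ is an isomorphism of $B$ onto the corner ring $\beta_s(1)B\beta_s(1)$. For such $\beta$, $R=S^{\mathrm{op}}*_\beta B*_\beta S$ is the unital ring equipped with a unital ring homomorphism $\phi:B\to R$ and monoid homomorphisms $s\mapsto s_-$ from $S^{\mathrm{op}}$ to $R$ (so $(su)_-=u_-s_-$, $1_-=1$)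 and $t\mapsto t_+$ from $S$ to $R$ (to the multiplicative monoid), universal with respect to: (1) $t_+\phi(b)=\phi(\beta_t(b))t_+$; (2) $\phi(b)s_-=s_-\phi(\beta_s(b))$; (3) $s_-s_+=1$; (4) $s_+s_-=\phi(\beta_s(1))$, for all $b\in B$, $s,t\in S$. It is $G$-graded with $g$-component $R_g=\bigcup_{s,t\in S,\ s^{-1}t=g}s_-\phi(B)t_+$. *)

(* Defs.v *)
From HB Require Import structures.
From mathcomp Require Import all_boot all_order all_algebra finmap.
From mathcomp Require Import monalg.
From mathcomp Require Import boolp classical_sets.

Set Implicit Arguments.
Unset Strict Implicit.
Unset Printing Implicit Defensive.

Import GRing.Theory.

Local Open Scope classical_set_scope.
Local Open Scope ring_scope.

(* All rings are unital and associative, neither commutative nor nonzero in   *)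
(* general: this is pzRingType.                                               *)

Definition idem_le (A : pzRingType) (f e : A) : Prop := e * f = f /\ f * e = f.

Section Corner.
Variables (A : pzRingType) (e : A).

Definition corner_pred : pred A := fun x => e * x * e == x.

(* For idempotent e, the condition e * x * e = x says that x lies in eAe, see *)
(* cornerE below.                                                             *)
Record corner (he : e * e = e) := Corner {
  corner_val : A;
  corner_valP : corner_pred corner_val }.

Variable he : e * e = e.

Lemma cornerE (x : A) : corner_pred x <-> exists a, x = e * a * e.
Proof.
split=> [/eqP<-|[a ->]]; first by exists x.
by apply/eqP; rewrite !mulrA he -!mulrA he.
Qed.

Lemma corner_zmod_closed : zmod_closed corner_pred.
Proof.
split=> [|x y /eqP xE /eqP yE]; rewrite /in_mem /=.
  by apply/eqP; rewrite mulr0 mul0r.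
by apply/eqP; rewrite mulrBr mulrBl xE yE.
Qed.

HB.instance Definition _ := [isSub for @corner_val he].
HB.instance Definition _ := [Choice of corner he by <:].
HB.instance Definition _ :=
  GRing.SubChoice_isSubZmodule.Build A corner_pred (corner he)
    corner_zmod_closed.

Lemma corner_mull (x : corner he) : e * \val x = \val x.
Proof. by rewrite -(eqP (valP x)) !mulrA he. Qed.

Lemma corner_mulr (x : corner he) : \val x * e = \val x.
Proof. by rewrite -(eqP (valP x)) -!mulrA he. Qed.

Lemma corner_mul_subproof (x y : corner he) : corner_pred (\val x * \val y).
Proof. by apply/eqP; rewrite mulrA corner_mull -mulrA corner_mulr. Qed.

Lemma corner_one_subproof : corner_pred e.
Proof. by apply/eqP; rewrite !he. Qed.

Definition corner_mul (x y : corner he) := Corner he (corner_mul_subproof x y).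
Definition corner_one := Corner he corner_one_subproof.

Lemma corner_mulA : associative corner_mul.
Proof. by move=> x y z; apply/val_inj; rewrite /= mulrA. Qed.
Lemma corner_mul1 : left_id corner_one corner_mul.
Proof. by move=> x; apply/val_inj; rewrite /= corner_mull. Qed.
Lemma corner_mulr1 : right_id corner_one corner_mul.
Proof. by move=> x; apply/val_inj; rewrite /= corner_mulr. Qed.
Lemma corner_mulDl : left_distributive corner_mul +%R.
Proof. by move=> x y z; apply/val_inj; rewrite /= mulrDl. Qed.
Lemma corner_mulDr : right_distributive corner_mul +%R.
Proof. by move=> x y z; apply/val_inj; rewrite /= mulrDr. Qed.

HB.instance Definition _ := GRing.Zmodule_isPzRing.Build (corner he)
  corner_mulA corner_mul1 corner_mulr1 corner_mulDl corner_mulDr.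

End Corner.

(* A homomorphism G -> Aut(A); each ract g is bijective with inverse          *)
(* ract g^-1.                                                                 *)
Record ringAction (G : groupType) (A : pzRingType) := RingAction {
  ract :> G -> {rmorphism A -> A};
  ract1 : forall a, ract 1%g a = a;
  ractM : forall g h a, ract (g * h)%g a = ract g (ract h a) }.

(* The skew group ring A *_alpha G: finitely supported families of elements   *)
(* of A indexed by G, where << a *g g >> is the monomial ag.                  *)
Definition skew (G : groupType) (A : pzRingType) (alpha : ringAction G A) : Type :=
  {malg A[G]}.

Section SkewGroupRing.
Variables (G : groupType) (A : pzRingType) (alpha : ringAction G A).

HB.instance Definition _ := GRing.Zmodule.on (skew alpha).

Definition skew_mono (a : A) (g : G) : skew alpha := << a *g g >>.

Definition skew_mul (x y : skew alpha) : skew alpha :=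
  \sum_(g <- msupp x) \sum_(h <- msupp y)
    skew_mono (x@_g * alpha g (y@_h)) (g * h)%g.

Definition skew_one : skew alpha := skew_mono 1 1%g.

Lemma skew_mono0 g : skew_mono 0 g = 0.
Proof. exact: monalgU0. Qed.

Lemma skew_monoD a b g : skew_mono (a + b) g = skew_mono a g + skew_mono b g.
Proof. exact: monalgUD. Qed.

Lemma skewE (x : skew alpha) : x = \sum_(g <- msupp x) skew_mono (x@_g) g.
Proof. exact: monalgE. Qed.

Lemma skew_ind (P : skew alpha -> Prop) :
  P 0 -> (forall x y, P x -> P y -> P (x + y)) ->
  (forall a g, P (skew_mono a g)) -> forall x, P x.
Proof. by move=> P0 PD PU x; rewrite (skewE x); apply: big_ind. Qed.

Lemma skew_mulEw (x y : skew alpha) (d1 d2 : {fset G}) :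
  (msupp x `<=` d1)%fset -> (msupp y `<=` d2)%fset ->
  skew_mul x y = \sum_(g <- d1) \sum_(h <- d2)
    skew_mono (x@_g * alpha g (y@_h)) (g * h)%g.
Proof.
move=> le1 le2; rewrite /skew_mul; apply/esym.
rewrite (big_fset_incl _ le1) => [|g _ /mcoeff_outdom gx].
  apply: eq_bigr => g _; apply/esym; apply: big_fset_incl => // h _.
  by move/mcoeff_outdom->; rewrite rmorph0 mulr0 skew_mono0.
by rewrite big1 // => h _; rewrite gx mul0r skew_mono0.
Qed.

Lemma skew_mulDl : left_distributive skew_mul +%R.
Proof.
move=> x y z.
rewrite (skew_mulEw (msuppD_le x y) (fsubset_refl _)).
rewrite (skew_mulEw (fsubsetUl _ (msupp y)) (fsubset_refl (msupp z))).
rewrite (skew_mulEw (fsubsetUr (msupp x) _) (fsubset_refl (msupp z))).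
rewrite -big_split; apply: eq_bigr => g _; rewrite -big_split.
by apply: eq_bigr => h _; rewrite /= mcoeffD mulrDl skew_monoD.
Qed.

Lemma skew_mulDr : right_distributive skew_mul +%R.
Proof.
move=> z x y.
rewrite (skew_mulEw (fsubset_refl _) (msuppD_le x y)).
rewrite (skew_mulEw (fsubset_refl (msupp z)) (fsubsetUl _ (msupp y))).
rewrite (skew_mulEw (fsubset_refl (msupp z)) (fsubsetUr (msupp x) _)).
rewrite -big_split; apply: eq_bigr => g _; rewrite -big_split.
by apply: eq_bigr => h _; rewrite /= mcoeffD rmorphD mulrDr skew_monoD.
Qed.

(* (ag)(bh) = (a alpha_g(b))(gh) *)
Lemma skew_mulUU a g b h :
  skew_mul (skew_mono a g) (skew_mono b h) =
  skew_mono (a * alpha g b) (g * h)%g.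
Proof.
rewrite (skew_mulEw msuppU_le msuppU_le) !big_seq_fset1.
by rewrite /skew_mono !mcoeffUU.
Qed.

Lemma skew_mul0l x : skew_mul 0 x = 0.
Proof. by apply: (addrI (skew_mul 0 x)); rewrite -skew_mulDl !addr0. Qed.

Lemma skew_mul0r x : skew_mul x 0 = 0.
Proof. by apply: (addrI (skew_mul x 0)); rewrite -skew_mulDr !addr0. Qed.

Lemma skew_mulA : associative skew_mul.
Proof.
elim/skew_ind=> [y z|x x' IHx IHx' y z|a g]; first by rewrite !skew_mul0l.
  by rewrite !skew_mulDl IHx IHx'.
elim/skew_ind=> [z|y y' IHy IHy' z|b h].
- by rewrite !(skew_mul0l, skew_mul0r).
- by rewrite !(skew_mulDl, skew_mulDr) IHy IHy'.
elim/skew_ind=> [|z z' IHz IHz'|c k].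
- by rewrite !skew_mul0r.
- by rewrite !skew_mulDr IHz IHz'.
by rewrite !skew_mulUU ractM rmorphM /= mulrA mulgA.
Qed.

Lemma skew_mul1 : left_id skew_one skew_mul.
Proof.
elim/skew_ind=> [|x y IHx IHy|a g]; first exact: skew_mul0r.
  by rewrite skew_mulDr IHx IHy.
by rewrite skew_mulUU ract1 mul1r mul1g.
Qed.

Lemma skew_mulr1 : right_id skew_one skew_mul.
Proof.
elim/skew_ind=> [|x y IHx IHy|a g]; first exact: skew_mul0l.
  by rewrite skew_mulDl IHx IHy.
by rewrite skew_mulUU rmorph1 mulr1 mulg1.
Qed.

HB.instance Definition _ := GRing.Zmodule_isPzRing.Build (skew alpha)
  skew_mulA skew_mul1 skew_mulr1 skew_mulDl skew_mulDr.

Lemma skew_mono_idem (e : A) (he : e * e = e) :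
  skew_mono e 1%g * skew_mono e 1%g = skew_mono e 1%g.
Proof. by rewrite [LHS]skew_mulUU ract1 he mulg1. Qed.

End SkewGroupRing.

(* e(A *_alpha G)e, where A is identified with the monomials a1 in the skew   *)
(* group ring; corner_skew_comp he g is the g-component e(Ag)e.               *)
Definition corner_skew (G : groupType) (A : pzRingType) (alpha : ringAction G A)
    (e : A) (he : e * e = e) : pzRingType :=
  corner (skew_mono_idem alpha he).

Definition corner_skew_comp (G : groupType) (A : pzRingType)
    (alpha : ringAction G A) (e : A) (he : e * e = e) (g : G) :
    set (corner_skew alpha he) :=
  [set x | exists a : A,
     \val x = skew_mono alpha e 1%g * skew_mono alpha a g
               * skew_mono alpha e 1%g].

(* Not necessarily unital ring endomorphisms.                                 *)
Record endr (B : pzRingType) := Endr {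
  endr_fun :> {additive B -> B};
  endrM : {morph endr_fun : x y / x * y} }.

Record cornerAction (M : monoidType) (B : pzRingType) := CornerAction {
  cact :> M -> endr B;
  cact1 : forall b, cact 1%g b = b;
  cactM : forall s t b, cact (s * t)%g b = cact s (cact t b);
  cact_inj : forall s, injective (cact s);
  cact_img : forall s,
    range (cact s) = [set cact s 1 * b * cact s 1 | b in [set: B]] }.

(* The generators and relations of M^op *_beta B *_beta M in a ring R: the    *)
(* maps phi, s |-> s_- and t |-> t_+ with the compatibilities (1)-(4).        *)
Record fracSystem (M : monoidType) (B : pzRingType) (beta : cornerAction M B)
    (R : pzRingType) := FracSystem {
  fs_phi : {rmorphism B -> R};
  fs_neg : M -> R;
  fs_pos : M -> R;
  fs_neg1 : fs_neg 1%g = 1;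
  fs_negM : forall s u, fs_neg (s * u)%g = fs_neg u * fs_neg s;
  fs_pos1 : fs_pos 1%g = 1;
  fs_posM : forall t u, fs_pos (t * u)%g = fs_pos t * fs_pos u;
  fs_pos_phi : forall t b, fs_pos t * fs_phi b = fs_phi (beta t b) * fs_pos t;
  fs_phi_neg : forall s b, fs_phi b * fs_neg s = fs_neg s * fs_phi (beta s b);
  fs_neg_pos : forall s, fs_neg s * fs_pos s = 1;
  fs_pos_neg : forall s, fs_pos s * fs_neg s = fs_phi (beta s 1) }.

Definition frac_morph (M : monoidType) (B : pzRingType)
    (beta : cornerAction M B) (R T : pzRingType)
    (X : fracSystem beta R) (Y : fracSystem beta T) (f : R -> T) : Prop :=
  [/\ forall b, f (fs_phi X b) = fs_phi Y b,
      forall s, f (fs_neg X s) = fs_neg Y s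
    & forall t, f (fs_pos X t) = fs_pos Y t].

(* (R, X) is (a model of) M^op *_beta B *_beta M; existence is frac_exists.   *)
Definition frac_universal (M : monoidType) (B : pzRingType)
    (beta : cornerAction M B) (R : pzRingType) (X : fracSystem beta R) : Prop :=
  forall (T : pzRingType) (Y : fracSystem beta T),
    (exists f : {rmorphism R -> T}, frac_morph X Y f) /\
    (forall f f' : {rmorphism R -> T},
       frac_morph X Y f -> frac_morph X Y f' -> f =1 f').

(* R_g, the union of the s_- phi(B) t_+ over s^-1 t = g, where i : M -> G is  *)
(* the inclusion.                                                             *)
Definition frac_comp (M : monoidType) (G : groupType) (i : M -> G)
    (B : pzRingType) (beta : cornerAction M B) (R : pzRingType)
    (X : fracSystem beta R) (g : G) : set R :=
  [set x | exists s t : M, ((i s)^-1 * i t)%g = g /\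
     exists b : B, x = fs_neg X s * fs_phi X b * fs_pos X t].

Definition graded_isomorphic (G : Type) (R T : pzRingType)
    (Rg : G -> set R) (Tg : G -> set T) : Prop :=
  exists f : {rmorphism R -> T},
    bijective f /\ forall g, f @` Rg g = Tg g.

Record submonoid (G : monoidType) := Submonoid {
  submon_set :> set G;
  submon1 : submon_set 1%g;
  submonM : forall s t, submon_set s -> submon_set t -> submon_set (s * t)%g }.

Section SubmonoidType.
Variables (G : monoidType) (S : submonoid G).

Definition submon : Type := set_type S.

HB.instance Definition _ := SubChoice.on submon.

Lemma submon_closed : monoid_closed (mem (S : set G)).
Proof.
split=> [|s t]; rewrite ?inE; first exact: submon1.
by move=> sS tS; apply: submonM.
Qed.

HB.instance Definition _ :=
  SubChoice_isSubMonoid.Build G (mem (S : set G)) submon submon_closed.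

End SubmonoidType.

Section Restriction.
Variables (G : groupType) (A : pzRingType) (alpha : ringAction G A).
Variables (S : submonoid G) (e : A) (he : e * e = e).
Hypothesis hS : forall s : submon S, idem_le (alpha (\val s) e) e.

Implicit Types (s t : submon S) (x y : corner he).

Lemma restr_subproof s x : corner_pred e (alpha (\val s) (\val x)).
Proof.
have [le1 le2] := hS s; apply/eqP.
have xE : alpha (\val s) (\val x) =
    alpha (\val s) e * alpha (\val s) (\val x) * alpha (\val s) e.
  by rewrite -!rmorphM corner_mull corner_mulr.
by rewrite xE !mulrA le1 -!mulrA le2.
Qed.

Definition restr_fun s x : corner he := Corner he (restr_subproof s x).

Lemma restr_zmod s : zmod_morphism (restr_fun s).
Proof. by move=> x y; apply/val_inj; rewrite /= rmorphB. Qed.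

HB.instance Definition _ s :=
  GRing.isZmodMorphism.Build (corner he) (corner he) (restr_fun s)
    (restr_zmod s).

Lemma restr_mul s : {morph restr_fun s : x y / x * y}.
Proof. by move=> x y; apply/val_inj; rewrite /= rmorphM. Qed.

Definition restr_endr s : endr (corner he) := Endr (restr_mul s).

Lemma restr1 x : restr_endr 1%g x = x.
Proof. by apply/val_inj; rewrite /= ract1. Qed.

Lemma restrM s t x : restr_endr (s * t)%g x = restr_endr s (restr_endr t x).
Proof. by apply/val_inj; rewrite /= ractM. Qed.

Lemma restr_inj s : injective (restr_endr s).
Proof.
move=> x y /(congr1 val) /= /(congr1 (alpha (\val s)^-1%g)).
by rewrite -!ractM mulVg !ract1 => /val_inj.
Qed.

Lemma restr_img s :
  range (restr_endr s) =
  [set restr_endr s 1 * x * restr_endr s 1 | x in [set: corner he]].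
Proof.
apply/seteqP; split=> _ [x _ <-].
  by exists (restr_endr s x) => //; rewrite -!endrM mul1r mulr1.
have yP : corner_pred e (e * alpha (\val s)^-1%g (\val x) * e).
  by apply/cornerE => //; exists (alpha (\val s)^-1%g (\val x)).
exists (Corner he yP) => //; apply/val_inj => /=.
by rewrite !rmorphM /= -ractM mulgV ract1.
Qed.

(* alpha'_s is the restriction of alpha_s to eAe.                             *)
Definition restr_action : cornerAction (submon S) (corner he) :=
  CornerAction restr1 restrM restr_inj restr_img.

End Restriction.

(* Existence of M^op *_beta B *_beta M: terms in the generators phi(b), s_-,  *)
(* t_+ modulo the congruence generated by the ring axioms and the relations.  *)
Section Existence.
Variables (M : monoidType) (B : pzRingType) (beta : cornerAction M B).

Inductive term : Type :=
| TB of B | TN of M | TP of M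
| Tadd of term & term | Topp of term | Tmul of term & term.

Inductive term_eq : term -> term -> Prop :=
| te_refl x : term_eq x x
| te_sym x y : term_eq x y -> term_eq y x
| te_trans x y z : term_eq x y -> term_eq y z -> term_eq x z
| te_add x x' y y' :
    term_eq x x' -> term_eq y y' -> term_eq (Tadd x y) (Tadd x' y')
| te_opp x x' : term_eq x x' -> term_eq (Topp x) (Topp x')
| te_mul x x' y y' :
    term_eq x x' -> term_eq y y' -> term_eq (Tmul x y) (Tmul x' y')
| te_addA x y z : term_eq (Tadd x (Tadd y z)) (Tadd (Tadd x y) z)
| te_addC x y : term_eq (Tadd x y) (Tadd y x)
| te_add0 x : term_eq (Tadd (TB 0) x) x
| te_addN x : term_eq (Tadd (Topp x) x) (TB 0)
| te_mulA x y z : term_eq (Tmul x (Tmul y z)) (Tmul (Tmul x y) z)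
| te_mul1 x : term_eq (Tmul (TB 1) x) x
| te_mulr1 x : term_eq (Tmul x (TB 1)) x
| te_mulDl x y z : term_eq (Tmul (Tadd x y) z) (Tadd (Tmul x z) (Tmul y z))
| te_mulDr x y z : term_eq (Tmul x (Tadd y z)) (Tadd (Tmul x y) (Tmul x z))
| te_phiD b c : term_eq (TB (b + c)) (Tadd (TB b) (TB c))
| te_phiM b c : term_eq (TB (b * c)) (Tmul (TB b) (TB c))
| te_neg1 : term_eq (TN 1%g) (TB 1)
| te_negM s u : term_eq (TN (s * u)%g) (Tmul (TN u) (TN s))
| te_pos1 : term_eq (TP 1%g) (TB 1)
| te_posM t u : term_eq (TP (t * u)%g) (Tmul (TP t) (TP u))
| te_pos_phi t b : term_eq (Tmul (TP t) (TB b)) (Tmul (TB (beta t b)) (TP t))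
| te_phi_neg s b : term_eq (Tmul (TB b) (TN s)) (Tmul (TN s) (TB (beta s b)))
| te_neg_pos s : term_eq (Tmul (TN s) (TP s)) (TB 1)
| te_pos_neg s : term_eq (Tmul (TP s) (TN s)) (TB (beta s 1)).

HB.instance Definition _ := gen_eqMixin term.
HB.instance Definition _ := gen_choiceMixin term.

Lemma term_equiv : equiv_class_of (fun x y => `[< term_eq x y >]).
Proof.
split=> [x|x y|y x z]; first exact/asboolP/te_refl.
  by apply/asboolP/asboolP; apply: te_sym.
by move=> /asboolP xy /asboolP yz; apply/asboolP/(te_trans xy).
Qed.

Definition term_rel := EquivRelPack term_equiv.

Definition frac := {eq_quot term_rel}%qT.

HB.instance Definition _ := Choice.on frac.

Definition frac_pi (x : term) : frac := \pi_frac%qT x.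

Lemma frac_piP x y : frac_pi x = frac_pi y <-> term_eq x y.
Proof. by split=> [/eqmodP/asboolP|xy] //; apply/eqmodP/asboolP. Qed.

Lemma frac_reprK x : frac_pi (repr x) = x.
Proof. exact: reprK. Qed.

Lemma frac_repr_pi x : term_eq (repr (frac_pi x)) x.
Proof. by apply/frac_piP; rewrite frac_reprK. Qed.

Lemma frac_ind (P : frac -> Prop) :
  (forall x, P (frac_pi x)) -> forall x, P x.
Proof. by move=> PP x; rewrite -(frac_reprK x). Qed.

Definition frac_add (x y : frac) := frac_pi (Tadd (repr x) (repr y)).
Definition frac_opp (x : frac) := frac_pi (Topp (repr x)).
Definition frac_mul (x y : frac) := frac_pi (Tmul (repr x) (repr y)).

Lemma frac_addE x y : frac_add (frac_pi x) (frac_pi y) = frac_pi (Tadd x y).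
Proof. by apply/frac_piP/te_add; apply: frac_repr_pi. Qed.
Lemma frac_oppE x : frac_opp (frac_pi x) = frac_pi (Topp x).
Proof. exact/frac_piP/te_opp/frac_repr_pi. Qed.
Lemma frac_mulE x y : frac_mul (frac_pi x) (frac_pi y) = frac_pi (Tmul x y).
Proof. by apply/frac_piP/te_mul; apply: frac_repr_pi. Qed.

Definition fracE := (frac_addE, frac_oppE, frac_mulE).

Lemma frac_addA : associative frac_add.
Proof.
elim/frac_ind=> x; elim/frac_ind=> y; elim/frac_ind=> z.
by rewrite !fracE; apply/frac_piP; constructor.
Qed.
Lemma frac_addC : commutative frac_add.
Proof.
elim/frac_ind=> x; elim/frac_ind=> y.
by rewrite !fracE; apply/frac_piP; apply: te_addC.
Qed.
Lemma frac_add0 : left_id (frac_pi (TB 0)) frac_add.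
Proof. by elim/frac_ind=> x; rewrite !fracE; apply/frac_piP/te_add0. Qed.
Lemma frac_addN : left_inverse (frac_pi (TB 0)) frac_opp frac_add.
Proof. by elim/frac_ind=> x; rewrite !fracE; apply/frac_piP/te_addN. Qed.

HB.instance Definition _ := GRing.isZmodule.Build frac
  frac_addA frac_addC frac_add0 frac_addN.

Lemma frac_mulA : associative frac_mul.
Proof.
elim/frac_ind=> x; elim/frac_ind=> y; elim/frac_ind=> z.
by rewrite !fracE; apply/frac_piP/te_mulA.
Qed.
Lemma frac_mul1 : left_id (frac_pi (TB 1)) frac_mul.
Proof. by elim/frac_ind=> x; rewrite !fracE; apply/frac_piP/te_mul1. Qed.
Lemma frac_mulr1 : right_id (frac_pi (TB 1)) frac_mul.
Proof. by elim/frac_ind=> x; rewrite !fracE; apply/frac_piP/te_mulr1. Qed.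
Lemma frac_mulDl : left_distributive frac_mul frac_add.
Proof.
elim/frac_ind=> x; elim/frac_ind=> y; elim/frac_ind=> z.
by rewrite !fracE; apply/frac_piP/te_mulDl.
Qed.
Lemma frac_mulDr : right_distributive frac_mul frac_add.
Proof.
elim/frac_ind=> x; elim/frac_ind=> y; elim/frac_ind=> z.
by rewrite !fracE; apply/frac_piP/te_mulDr.
Qed.

HB.instance Definition _ := GRing.Zmodule_isPzRing.Build frac
  frac_mulA frac_mul1 frac_mulr1 frac_mulDl frac_mulDr.

Lemma frac_piD x y : frac_pi (Tadd x y) = frac_pi x + frac_pi y.
Proof. by rewrite -frac_addE. Qed.
Lemma frac_piN x : frac_pi (Topp x) = - frac_pi x.
Proof. by rewrite -frac_oppE. Qed.
Lemma frac_piM x y : frac_pi (Tmul x y) = frac_pi x * frac_pi y.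
Proof. by rewrite -frac_mulE. Qed.

Definition frac_phi (b : B) : frac := frac_pi (TB b).
Definition frac_neg (s : M) : frac := frac_pi (TN s).
Definition frac_pos (t : M) : frac := frac_pi (TP t).

Lemma frac_phi_nmod : nmod_morphism frac_phi.
Proof.
by split=> // b c; rewrite /frac_phi -frac_piD; apply/frac_piP/te_phiD.
Qed.

Lemma frac_phi_monoid : monoid_morphism frac_phi.
Proof.
by split=> // b c; rewrite /frac_phi -frac_piM; apply/frac_piP/te_phiM.
Qed.

HB.instance Definition _ :=
  GRing.isNmodMorphism.Build B frac frac_phi frac_phi_nmod.
HB.instance Definition _ :=
  GRing.isMonoidMorphism.Build B frac frac_phi frac_phi_monoid.

Program Definition frac_system : fracSystem beta frac :=
  @FracSystem M B beta frac frac_phi frac_neg frac_pos _ _ _ _ _ _ _ _.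
Next Obligation. exact/frac_piP/te_neg1. Qed.
Next Obligation. by rewrite /frac_neg -frac_piM; apply/frac_piP/te_negM. Qed.
Next Obligation. exact/frac_piP/te_pos1. Qed.
Next Obligation. by rewrite /frac_pos -frac_piM; apply/frac_piP/te_posM. Qed.
Next Obligation. by rewrite -!frac_piM; apply/frac_piP/te_pos_phi. Qed.
Next Obligation. by rewrite -!frac_piM; apply/frac_piP/te_phi_neg. Qed.
Next Obligation. by rewrite -!frac_piM; apply/frac_piP/te_neg_pos. Qed.
Next Obligation. by rewrite -!frac_piM; apply/frac_piP/te_pos_neg. Qed.

Section Eval.
Variables (T : pzRingType) (Y : fracSystem beta T).

Fixpoint term_eval (x : term) : T :=
  match x with
  | TB b => fs_phi Y b
  | TN s => fs_neg Y s
  | TP t => fs_pos Y t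
  | Tadd x y => term_eval x + term_eval y
  | Topp x => - term_eval x
  | Tmul x y => term_eval x * term_eval y
  end.

Lemma term_eval_eq x y : term_eq x y -> term_eval x = term_eval y.
Proof.
elim=> {x y} //=.
- by move=> x y z _ -> _ ->.
- by move=> x x' y y' _ -> _ ->.
- by move=> x x' _ ->.
- by move=> x x' y y' _ -> _ ->.
- by move=> x y z; rewrite addrA.
- by move=> x y; rewrite addrC.
- by move=> x; rewrite rmorph0 add0r.
- by move=> x; rewrite rmorph0 addNr.
- by move=> x y z; rewrite mulrA.
- by move=> x; rewrite rmorph1 mul1r.
- by move=> x; rewrite rmorph1 mulr1.
- by move=> x y z; rewrite mulrDl.
- by move=> x y z; rewrite mulrDr.
- by move=> b c; rewrite rmorphD.
- by move=> b c; rewrite rmorphM.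
- by rewrite fs_neg1 rmorph1.
- by move=> s u; rewrite fs_negM.
- by rewrite fs_pos1 rmorph1.
- by move=> t u; rewrite fs_posM.
- by move=> t b; rewrite fs_pos_phi.
- by move=> s b; rewrite fs_phi_neg.
- by move=> s; rewrite fs_neg_pos rmorph1.
- by move=> s; rewrite fs_pos_neg.
Qed.

Definition frac_lift (x : frac) : T := term_eval (repr x).

Lemma frac_liftE x : frac_lift (frac_pi x) = term_eval x.
Proof. exact/term_eval_eq/frac_repr_pi. Qed.

Lemma frac_lift_nmod : nmod_morphism frac_lift.
Proof.
split=> [|]; first by rewrite [LHS]frac_liftE /= rmorph0.
by elim/frac_ind=> x; elim/frac_ind=> y; rewrite -frac_piD !frac_liftE.
Qed.

Lemma frac_lift_monoid : monoid_morphism frac_lift.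
Proof.
split=> [|]; first by rewrite [LHS]frac_liftE /= rmorph1.
by elim/frac_ind=> x; elim/frac_ind=> y; rewrite -frac_piM !frac_liftE.
Qed.

HB.instance Definition _ :=
  GRing.isNmodMorphism.Build frac T frac_lift frac_lift_nmod.
HB.instance Definition _ :=
  GRing.isMonoidMorphism.Build frac T frac_lift frac_lift_monoid.

End Eval.

Lemma frac_systemP : frac_universal frac_system.
Proof.
move=> T Y; split.
  by exists (frac_lift Y); split=> ?; apply: frac_liftE.
move=> f f' [fB fN fP] [fB' fN' fP']; elim/frac_ind.
elim=> [b|s|t|x IHx y IHy|x IHx|x IHx y IHy].
- by rewrite [LHS]fB fB'.
- by rewrite [LHS]fN fN'.
- by rewrite [LHS]fP fP'.
- by rewrite frac_piD !rmorphD IHx IHy.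
- by rewrite frac_piN !rmorphN IHx.
- by rewrite frac_piM !rmorphM IHx IHy.
Qed.

End Existence.

Lemma frac_exists (M : monoidType) (B : pzRingType) (beta : cornerAction M B) :
  exists (R : pzRingType) (X : fracSystem beta R), frac_universal X.
Proof. by exists (frac beta), (frac_system beta); apply: frac_systemP. Qed.

(* Main.v *)
Require Import Defs.
From HB Require Import structures.
From mathcomp Require Import all_boot all_order all_algebra finmap.
From mathcomp Require Import monalg.
From mathcomp Require Import boolp classical_sets.

Set Implicit Arguments.
Unset Strict Implicit.
Unset Printing Implicit Defensive.

Import GRing.Theory.
Local Open Scope ring_scope.

(* In e(A *_alpha G)e the elements b 1, e s^-1 e and e t e satisfy the        *)
(* relations of S^op *_alpha' (eAe) *_alpha' S, whence a morphism f by        *)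
(* universality. Its inverse sends e(ag)e to s_- phi(e alpha_s(a) e) t_+ for  *)
(* any s, t with g = s^-1 t; this does not depend on s, t and is              *)
(* multiplicative because S admits common left multiples. The composite on    *)
(* the universal side fixes the generators, so it is the identity.            *)

(** In the corner, e(ag)e = (e a alpha_g(e)) g. Put s_- = e s^-1 e and t_+ = e t e. Since alpha_s(e)
    <= e, equivalently e <= alpha_s^-1(e), the idempotent inside a product of such elements is
    absorbed, which gives the defining relations ([corner_skew_system]) and hence f. As f sends s_-
    phi(b) t_+ to e(alpha_s^-1(b) s^-1 t)e, its inverse has to send e(ag)e, g = s^-1 t, to
    [frac_mono s t a]. Since G = S^-1 S, two elements of S have a common left multiple
    ([submon_ore]). This makes the value independent of s and t ([frac_mono_indep]) and gives the
    product rule [frac_monoM]. One composite is the identity by a check on monomials, the other by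
    uniqueness in the universal property; degrees are read off from s^-1 t. *)

Section FracSystem.
Variables (M : monoidType) (B : pzRingType) (beta : cornerAction M B).
Variables (R : pzRingType) (X : fracSystem beta R).

(** * Calculus of the monomials s_- phi(b) t_+ *)

Lemma fs_negK s : fs_neg X s * fs_phi X (beta s 1) = fs_neg X s.
Proof. by rewrite -fs_pos_neg mulrA fs_neg_pos mul1r. Qed.

Lemma fs_posK t : fs_phi X (beta t 1) * fs_pos X t = fs_pos X t.
Proof. by rewrite -fs_pos_neg -mulrA fs_neg_pos mulr1. Qed.

Lemma fs_neg_phi_posK s t b :
  fs_neg X s * fs_phi X (beta s 1 * b * beta t 1) * fs_pos X t =
  fs_neg X s * fs_phi X b * fs_pos X t.
Proof. by rewrite !rmorphM !mulrA fs_negK -!mulrA fs_posK. Qed.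

Lemma fs_neg_phi_pos s b :
  fs_neg X s * fs_phi X (beta s b) * fs_pos X s = fs_phi X b.
Proof. by rewrite -fs_phi_neg -mulrA fs_neg_pos mulr1. Qed.

(** Insert p_- p_+ = 1 on the left and q_- q_+ = 1 on the right: the middle becomes (pt)_+ (qu)_-, a
    single idempotent because pt = qu. *)
Lemma fs_pos_neg_ore p q t u : (p * t = q * u)%g ->
  fs_pos X t * fs_neg X u =
  fs_neg X p * fs_phi X (beta (p * t)%g 1) * fs_pos X q.
Proof.
move=> ptqu; rewrite -fs_pos_neg {2}ptqu.
rewrite fs_posM fs_negM !mulrA fs_neg_pos mul1r.
by rewrite -!mulrA fs_neg_pos mulr1.
Qed.

Lemma fs_mul_ore p q s t u v b c : (p * t = q * u)%g ->
  fs_neg X s * fs_phi X b * fs_pos X t *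
    (fs_neg X u * fs_phi X c * fs_pos X v) =
  fs_neg X (p * s)%g * fs_phi X (beta p b * beta (p * t)%g 1 * beta q c)
    * fs_pos X (q * v)%g.
Proof.
move=> ptqu; rewrite fs_negM fs_posM !rmorphM !mulrA.
rewrite -(mulrA (fs_neg X s) (fs_neg X p)) -fs_phi_neg.
rewrite -(mulrA _ (fs_phi X (beta q c))) -fs_pos_phi !mulrA.
by rewrite -[_ * _ * fs_pos X t * _]mulrA (fs_pos_neg_ore ptqu) !mulrA.
Qed.

End FracSystem.

(** * Additive maps out of the skew group ring, as the direct sum of its components Ag *)

Section SkewAdditive.
Variables (G : groupType) (A : pzRingType) (alpha : ringAction G A).
Variables (V : zmodType) (h : G -> {additive A -> V}).

Definition skew_lift (x : Defs.skew alpha) : V :=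
  \sum_(g <- msupp x) h g (x@_g).

Lemma skew_liftEw (x : Defs.skew alpha) (d : {fset G}) :
  (msupp x `<=` d)%fset ->
  skew_lift x = \sum_(g <- d) h g (x@_g).
Proof.
move=> le; apply: big_fset_incl => // g _ /mcoeff_outdom ->.
by rewrite raddf0.
Qed.

Lemma skew_liftU a g : skew_lift (skew_mono alpha a g) = h g a.
Proof. by rewrite (skew_liftEw msuppU_le) big_seq_fset1 mcoeffUU. Qed.

Lemma skew_lift_nmod : nmod_morphism skew_lift.
Proof.
split=> [|x y]; first by rewrite /skew_lift msupp0 big_seq_fset0.
rewrite (skew_liftEw (msuppD_le x y)).
rewrite (skew_liftEw (fsubsetUl _ (msupp y))).
rewrite (skew_liftEw (fsubsetUr (msupp x) _)).
by rewrite -big_split; apply: eq_bigr => g _; rewrite /= mcoeffD raddfD.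
Qed.

HB.instance Definition _ :=
  GRing.isNmodMorphism.Build (Defs.skew alpha) V skew_lift skew_lift_nmod.

End SkewAdditive.

(** * Compression to a corner, and the compressed monomials e(ag)e *)

Section CornerElements.
Variables (A : pzRingType) (e : A) (he : e * e = e).

Lemma corner_proj_subproof a : corner_pred e (e * a * e).
Proof. by apply/cornerE => //; exists a. Qed.

Definition corner_proj a : corner he := Corner he (corner_proj_subproof a).

Lemma corner_proj_nmod : nmod_morphism corner_proj.
Proof.
split=> [|a b]; apply/val_inj; first by rewrite /= mulr0 mul0r.
by rewrite /= mulrDr mulrDl.
Qed.

HB.instance Definition _ :=
  GRing.isNmodMorphism.Build A (corner he) corner_proj corner_proj_nmod.

Lemma corner_projK (x : corner he) : corner_proj (val x) = x.
Proof. by apply/val_inj; rewrite /= corner_mull corner_mulr. Qed.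

End CornerElements.

Section CornerSkew.
Variables (G : groupType) (A : pzRingType) (alpha : ringAction G A).
Variables (e : A) (he : e * e = e).

Definition corner_skew_mono (a : A) (g : G) : corner_skew alpha he :=
  corner_proj (skew_mono_idem alpha he) (skew_mono alpha a g).

Lemma val_corner_skew_mono a g :
  val (corner_skew_mono a g) = skew_mono alpha (e * a * alpha g e) g.
Proof.
rewrite /= [X in X * _]skew_mulUU [LHS]skew_mulUU.
by rewrite ract1 mul1g mulg1.
Qed.

Lemma eq_corner_skew_mono a b g :
  e * a * alpha g e = e * b * alpha g e ->
  corner_skew_mono a g = corner_skew_mono b g.
Proof. by move=> ab; apply/val_inj; rewrite !val_corner_skew_mono ab. Qed.

Lemma corner_skew_monoM a g b h :
  corner_skew_mono a g * corner_skew_mono b h =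
  corner_skew_mono (a * alpha g (e * b)) (g * h)%g.
Proof.
apply/val_inj; rewrite val_corner_skew_mono.
transitivity (val (corner_skew_mono a g) * val (corner_skew_mono b h)) => //.
rewrite !val_corner_skew_mono [LHS]skew_mulUU !rmorphM /= -ractM !mulrA.
by rewrite -(mulrA (e * a)) -rmorphM he.
Qed.

Lemma corner_skew_mono1 : corner_skew_mono 1 1%g = 1.
Proof.
by apply/val_inj; rewrite val_corner_skew_mono ract1 mulr1 he.
Qed.

End CornerSkew.

(** * Order and Ore properties, and the generators inside e(A *_alpha G)e *)

Section Iso.
Variables (A : pzRingType) (G : groupType) (alpha : ringAction G A).
Variable S : submonoid G.
Hypothesis hGS :
  forall g : G, exists s t : submon S, g = ((\val s)^-1 * \val t)%g.
Variables (e : A) (he : e * e = e).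
Hypothesis hS : forall s : submon S, idem_le (alpha (\val s) e) e.

Implicit Types (s t u v p q : submon S) (g h : G).

Local Notation T := (corner_skew alpha he).
Local Notation cm := (corner_skew_mono alpha he).
Local Notation proj := (corner_proj he).
Local Notation beta := (restr_action he hS).

Let le1 s : e * alpha (\val s) e = alpha (\val s) e.
Proof. by case: (hS s). Qed.
Let le2 s : alpha (\val s) e * e = alpha (\val s) e.
Proof. by case: (hS s). Qed.

Lemma ractVK g a : alpha g^-1%g (alpha g a) = a.
Proof. by rewrite -ractM mulVg ract1. Qed.

(** Apply alpha_s^-1 to alpha_s(e) e = alpha_s(e). *)
Lemma idem_le_ractV s : e * alpha (\val s)^-1%g e = e.
Proof. by rewrite -{1}(ractVK (\val s) e) -rmorphM le2 ractVK. Qed.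

(** Write t u^-1 as p^-1 q with p, q in S and clear denominators. *)
Lemma submon_ore t u : exists p q, (p * t = q * u)%g.
Proof.
have [p [q tu]] := hGS (\val t * (\val u)^-1)%g.
exists p, q; apply/val_inj => /=.
have -> : val t = ((\val t * (\val u)^-1) * \val u)%g.
  by rewrite -mulgA mulVg mulg1.
by rewrite tu !mulgA mulgV mul1g.
Qed.

Definition corner_skew_phi (b : corner he) : T := cm (val b) 1%g.

Lemma corner_skew_phi_nmod : nmod_morphism corner_skew_phi.
Proof.
split=> [|b c]; rewrite /corner_skew_phi /corner_skew_mono.
  by rewrite skew_mono0 raddf0.
by rewrite /= skew_monoD raddfD.
Qed.

Lemma corner_skew_phi_monoid : monoid_morphism corner_skew_phi.
Proof.
split=> [|b c]; rewrite /corner_skew_phi.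
  rewrite -corner_skew_mono1; apply: eq_corner_skew_mono.
  by rewrite /= mulr1 he.
by rewrite corner_skew_monoM mulg1 ract1 corner_mull.
Qed.

HB.instance Definition _ :=
  GRing.isNmodMorphism.Build (corner he) T corner_skew_phi corner_skew_phi_nmod.
HB.instance Definition _ :=
  GRing.isMonoidMorphism.Build (corner he) T corner_skew_phi
    corner_skew_phi_monoid.

Program Definition corner_skew_system : fracSystem beta T :=
  @FracSystem _ _ _ T corner_skew_phi (fun s => cm 1 (\val s)^-1%g)
    (fun t => cm 1 (\val t)) _ _ _ _ _ _ _ _.
Next Obligation. by rewrite invg1 corner_skew_mono1. Qed.
Next Obligation.
rewrite corner_skew_monoM invgM mulr1 mul1r; apply: eq_corner_skew_mono.
by rewrite idem_le_ractV mulr1.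
Qed.
Next Obligation. exact: corner_skew_mono1. Qed.
Next Obligation.
rewrite corner_skew_monoM mulr1 mul1r; apply: eq_corner_skew_mono.
by rewrite mulr1 ractM -!mulrA -!rmorphM le1.
Qed.
Next Obligation.
rewrite /corner_skew_phi !corner_skew_monoM mul1r corner_mull mulg1 mul1g ract1.
by rewrite mulr1 /= -{2}[val b](corner_mulr b) rmorphM -!mulrA le2 -rmorphM
  corner_mulr.
Qed.
Next Obligation.
rewrite /corner_skew_phi !corner_skew_monoM !ract1 mulg1 mul1g mulr1 mul1r.
rewrite corner_mulr rmorphM /= ractVK; apply: eq_corner_skew_mono.
by rewrite !mulrA idem_le_ractV corner_mull.
Qed.
Next Obligation.
rewrite corner_skew_monoM mul1r mulr1 mulVg -corner_skew_mono1.
by apply: eq_corner_skew_mono; rewrite idem_le_ractV mulr1.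
Qed.
Next Obligation.
rewrite corner_skew_monoM mul1r mulr1 mulgV.
by apply: eq_corner_skew_mono.
Qed.

(** * The inverse map, from the skew group ring to R *)

Variables (R : pzRingType) (X : fracSystem beta R).

Definition frac_mono s t (a : A) : R :=
  fs_neg X s * fs_phi X (proj (alpha (\val s) a)) * fs_pos X t.

Lemma frac_mono_nmod s t : nmod_morphism (frac_mono s t).
Proof.
split=> [|a b]; rewrite /frac_mono ?raddf0 ?mulr0 ?mul0r //.
by rewrite !raddfD mulrDr mulrDl.
Qed.

HB.instance Definition _ s t :=
  GRing.isNmodMorphism.Build A R (frac_mono s t) (frac_mono_nmod s t).

(** Between p_- and p_+ only the compression by beta_p(1) = alpha_p(e) counts. It turns e
    alpha_{ps}(a) e into beta_p(e alpha_s(a) e), and p_-, p_+ undo beta_p. *)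
Lemma frac_mono_scale p s t a :
  frac_mono (p * s)%g (p * t)%g a = frac_mono s t a.
Proof.
rewrite /frac_mono fs_negM fs_posM -!mulrA; congr (_ * _).
rewrite !mulrA; congr (_ * _).
rewrite -fs_neg_phi_posK -[RHS](fs_neg_phi_pos _ p).
congr (_ * fs_phi X _ * _); apply/val_inj => /=.
by rewrite !rmorphM /= -ractM !mulrA le2 -!mulrA le1.
Qed.

(** Pass to a common denominator ps = qu; then pt = qv as well, and scaling applies to both
    sides. *)
Lemma frac_mono_indep s t u v a :
  ((\val s)^-1 * \val t = (\val u)^-1 * \val v)%g ->
  frac_mono s t a = frac_mono u v a.
Proof.
move=> stuv; have [p [q psqu]] := submon_ore s u.
rewrite -(frac_mono_scale p s t) -(frac_mono_scale q u v) psqu.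
congr (frac_mono _ _ _); apply/val_inj => /=.
have -> : val t = (\val s * (\val u)^-1 * \val v)%g.
  by rewrite -mulgA -stuv mulgA mulgV mul1g.
have /= := congr1 val psqu; rewrite !mulgA => ->.
by rewrite -(mulgA _ (val u)) mulgV mulg1.
Qed.

Lemma frac_monoM p q s t u v a b : (p * t = q * u)%g ->
  frac_mono s t a * frac_mono u v b =
  frac_mono (p * s)%g (q * v)%g (a * alpha ((\val s)^-1 * \val t)%g (e * b)).
Proof.
move=> ptqu; rewrite /frac_mono (fs_mul_ore _ _ _ _ _ ptqu).
(* Compressing both middle terms by beta_{ps}(1) and beta_{qv}(1) reduces the claim to an identity
   in eAe. *)
rewrite -[LHS]fs_neg_phi_posK -[RHS]fs_neg_phi_posK.
congr (_ * fs_phi X _ * _); apply/val_inj => /=.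
have ptE x : alpha (\val p * \val t)%g x = alpha (\val q * \val u)%g x.
  by rewrite [(_ * _)%g](congr1 val ptqu).
have psE x : alpha (\val p * \val s)%g (alpha ((\val s)^-1 * \val t)%g x) =
    alpha (\val p * \val t)%g x.
  by rewrite -ractM !mulgA -(mulgA _ (val s)) mulgV mulg1.
have psK : alpha (\val p * \val s)%g e * e = alpha (\val p * \val s)%g e.
  exact: (le2 (p * s)%g).
have qvK : e * alpha (\val q * \val v)%g e = alpha (\val q * \val v)%g e.
  exact: (le1 (q * v)%g).
rewrite (rmorphM (alpha (\val p * \val s)%g)) psE.
rewrite (rmorphM (alpha (\val p * \val t)%g)) (ptE b) /= !mulrA psK.
rewrite -!(mulrA _ e) qvK !rmorphM /= !ractM !mulrA.
rewrite -(rmorphM (alpha (\val p)) (alpha (\val s) e) e) le2.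
rewrite -(mulrA _ (alpha (\val p) e)) -(rmorphM _ e) le1.
rewrite -(mulrA _ (alpha (\val q) e) (alpha (\val q) (alpha (\val v) _))).
rewrite -(rmorphM _ e) le1; have := ptE e; rewrite !ractM => ->.
by rewrite -(mulrA _ _ (alpha (\val q) e)) -(rmorphM _ _ e) le2.
Qed.

Let den g : submon S := projT1 (cid (hGS g)).
Let num g : submon S := projT1 (cid (projT2 (cid (hGS g)))).

Let den_num g : ((\val (den g))^-1 * \val (num g))%g = g.
Proof. by rewrite /den /num; case: (cid _) => s /= ?; case: (cid _). Qed.

(** Defined on the whole skew group ring, where an additive map is given freely on each Ag; the
    choice of [den] and [num] is immaterial by [frac_mono_indep]. *)
Definition frac_of_skew : Defs.skew alpha -> R :=
  skew_lift (fun g => frac_mono (den g) (num g)).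

HB.instance Definition _ := GRing.Additive.on frac_of_skew.

Lemma frac_of_skewU s t a :
  frac_of_skew (skew_mono alpha a ((\val s)^-1 * \val t)%g) = frac_mono s t a.
Proof. by rewrite [LHS]skew_liftU; apply: frac_mono_indep; rewrite den_num. Qed.

(** The inserted e is the idempotent between two compressed factors. On the corner x e = x, so the
    restriction is multiplicative. *)
Lemma frac_of_skewM x y :
  frac_of_skew (x * skew_mono alpha e 1%g * y) =
  frac_of_skew x * frac_of_skew y.
Proof.
elim/skew_ind: x => [|x x' IHx IHx'|a g].
- by rewrite !mul0r raddf0 mul0r.
- by rewrite !mulrDl !raddfD /= mulrDl IHx IHx'.
elim/skew_ind: y => [|y y' IHy IHy'|b h].
- by rewrite !mulr0 raddf0 mulr0.
- by rewrite !mulrDr !raddfD /= mulrDr IHy IHy'.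
rewrite -(den_num g) -(den_num h) !frac_of_skewU.
set s := den g; set t := num g; set u := den h; set v := num h.
have [p [q ptqu]] := submon_ore t u.
rewrite (frac_monoM _ _ _ _ ptqu) -frac_of_skewU.
rewrite [X in X * _]skew_mulUU [X in frac_of_skew X]skew_mulUU.
rewrite mulg1 rmorphM mulrA; congr (frac_of_skew (skew_mono _ _ _)).
have tuE : (\val t * (\val u)^-1 = (\val p)^-1 * \val q)%g.
  have /= ptE := congr1 val ptqu.
  rewrite -(mulKg (\val p) (_ * _)%g) (mulgA (val p)) ptE.
  by rewrite -(mulgA (val q)) mulgV mulg1.
by rewrite /= invgM !mulgA -(mulgA _ (val t)) tuE !mulgA.
Qed.

Lemma frac_of_skew_val_proj x :
  frac_of_skew (val (corner_proj (skew_mono_idem alpha he) x)) = frac_of_skew x.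
Proof.
have frac1 : frac_of_skew (skew_mono alpha e 1%g) = 1.
  have -> : (1 = (\val (1 : submon S))^-1 * \val (1 : submon S) :> G)%g.
    by rewrite mulVg.
  rewrite frac_of_skewU /frac_mono fs_neg1 fs_pos1 mul1r mulr1.
  rewrite -(rmorph1 (fs_phi X)); congr (fs_phi X _); apply/val_inj => /=.
  by rewrite ract1 !he.
have idem := skew_mono_idem alpha he.
(* Each outer idempotent is doubled so that [frac_of_skewM] can split it off as a factor sent to
   1. *)
rewrite /= -[X in _ * X]mulr1 -[X in X * x]idem.
rewrite -{3}idem mulr1 mulrA [LHS]frac_of_skewM.
by rewrite frac1 mulr1 frac_of_skewM frac1 mul1r.
Qed.

Lemma frac_of_skew_cm s t a :
  frac_of_skew (val (cm a ((\val s)^-1 * \val t)%g)) = frac_mono s t a.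
Proof. by rewrite frac_of_skew_val_proj frac_of_skewU. Qed.

Let corner_proj1 : proj 1 = 1.
Proof. by apply/val_inj; rewrite /= mulr1 he. Qed.

Lemma frac_of_skew_neg s : frac_of_skew (val (cm 1 (\val s)^-1%g)) = fs_neg X s.
Proof.
have := frac_of_skew_cm s 1%g 1; rewrite /= mulg1 => ->.
by rewrite /frac_mono fs_pos1 rmorph1 corner_proj1 rmorph1 !mulr1.
Qed.

Lemma frac_of_skew_pos t : frac_of_skew (val (cm 1 (\val t))) = fs_pos X t.
Proof.
have := frac_of_skew_cm 1%g t 1; rewrite /= invg1 mul1g => ->.
by rewrite /frac_mono fs_neg1 rmorph1 corner_proj1 rmorph1 !mul1r.
Qed.

Lemma frac_of_skew_phi b : frac_of_skew (val (corner_skew_phi b)) = fs_phi X b.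
Proof.
have := frac_of_skew_cm 1%g 1%g (val b); rewrite /= invg1 mul1g => ->.
by rewrite /frac_mono fs_neg1 fs_pos1 mul1r mulr1 ract1 corner_projK.
Qed.

Definition frac_of_corner (x : T) : R := frac_of_skew (val x).

Lemma frac_of_corner_nmod : nmod_morphism frac_of_corner.
Proof. by split=> [|x y]; rewrite /frac_of_corner ?raddf0 ?raddfD. Qed.

Lemma frac_of_corner_monoid : monoid_morphism frac_of_corner.
Proof.
split=> [|x y]; last by rewrite /frac_of_corner -frac_of_skewM corner_mulr.
transitivity (frac_of_corner (corner_skew_phi 1)); first by rewrite rmorph1.
by rewrite [LHS]frac_of_skew_phi rmorph1.
Qed.

HB.instance Definition _ :=
  GRing.isNmodMorphism.Build T R frac_of_corner frac_of_corner_nmod.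
HB.instance Definition _ :=
  GRing.isMonoidMorphism.Build T R frac_of_corner frac_of_corner_monoid.

(** * The two maps are mutually inverse and graded *)

Variable f : {rmorphism R -> T}.
Hypothesis fX : frac_morph X corner_skew_system f.

Lemma frac_morph_monoE s t b : f (fs_neg X s * fs_phi X b * fs_pos X t) =
  cm (alpha (\val s)^-1%g (\val b)) ((\val s)^-1 * \val t)%g.
Proof.
have [fphi fneg fpos] := fX.
rewrite !rmorphM fphi fneg fpos /= /corner_skew_phi.
rewrite !corner_skew_monoM mulg1 mul1r corner_mull; apply: eq_corner_skew_mono.
by rewrite mulr1 ractM -!mulrA -!rmorphM le1.
Qed.

Lemma frac_of_cornerK : cancel frac_of_corner f.
Proof.
move=> x; rewrite -(corner_projK x) /frac_of_corner frac_of_skew_val_proj.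
elim/skew_ind: (val x) => [|y z IHy IHz|a g].
- by rewrite !raddf0.
- by rewrite !raddfD /= IHy IHz.
rewrite -(den_num g) frac_of_skewU frac_morph_monoE.
apply: eq_corner_skew_mono.
by rewrite /= !rmorphM /= ractVK ractM !mulrA idem_le_ractV -mulrA -rmorphM le1.
Qed.

Lemma frac_morphK : frac_universal X -> cancel f frac_of_corner.
Proof.
move=> hX x; have [_ uniq] := hX R X; have [fphi fneg fpos] := fX.
(* The composite and the identity are both morphisms from [X] to itself. *)
apply: (uniq (frac_of_corner \o f : {rmorphism R -> R})
             (idfun : {rmorphism R -> R})).
  split=> [b|s|t] /=.
  - by rewrite fphi; apply: frac_of_skew_phi.
  - by rewrite fneg; apply: frac_of_skew_neg.
  - by rewrite fpos; apply: frac_of_skew_pos.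
by split.
Qed.

Lemma frac_morph_comp g :
  (f @` frac_comp (val : submon S -> G) X g = corner_skew_comp g)%classic.
Proof.
apply/seteqP; split=> [_ [_ [s [t [<- [b ->]]]] <-]|x [a xE]] /=.
  rewrite frac_morph_monoE; eexists; reflexivity.
have {xE} -> : x = cm a g by apply/val_inj.
(* The inverse sends e(ag)e to [frac_mono (den g) (num g) a], which has degree g by its form. *)
exists (frac_of_corner (cm a g)); last exact: frac_of_cornerK.
exists (den g), (num g); split; first exact: den_num.
rewrite -{1}(den_num g) [frac_of_corner _]frac_of_skew_cm.
by eexists; reflexivity.
Qed.

End Iso.

Theorem proposition3p3 (A : pzRingType) (G : groupType) (alpha : ringAction G A)
    (S : submonoid G)
    (hGS : forall g : G, exists s t : submon S, g = ((\val s)^-1 * \val t)%g)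
    (e : A) (he : e * e = e) (he0 : e <> 0) (he1 : e <> 1)
    (hS : forall s : submon S, idem_le (alpha (\val s) e) e)
    (R : pzRingType) (X : fracSystem (restr_action he hS) R)
    (hX : frac_universal X) :
  graded_isomorphic (frac_comp (val : submon S -> G) X)
    (@corner_skew_comp G A alpha e he).
Proof.
have [[f fX] _] := hX _ (corner_skew_system he hS).
exists f; split; last exact: (frac_morph_comp hGS fX).
by exists (frac_of_corner hGS X); [apply: frac_morphK | apply: frac_of_cornerK].
Qed.
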